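(* Consider the optimal control problem with terminal cost $$\min_{u(\cdot)\in\mathcal U}\Big[K(x(t_1))+\int_{t_0}^{t_1}L(x(t),u(t))\,dt\Big]\quad\text{subject to}\quad \dot x=f(x,u),\ x(t_0)=x_0,\ x(t_1)\in S_1,$$ where $K\colon\mathbb R^n\to\mathbb R$ is a smooth function, $t_0$ and $x_0$ are fixed, and $t_1$ is free. Let $x_1^\star=x^\star(t_1^\star)$ be the terminal point of the optimal trajectory, at the optimal terminal time $t_1^\star$, and let $[(-1,\mu)]\in\mathbb P(T^*\mathbb R^{n+1})$ be the costate corresponding to the variables $\hat y=(y^0,y)=(x^0-K(x),x)$, where $x^0(t)=K(x(t))+\int_{t_0}^tL(x(s),u(s))\,ds$. Then the transversality condition for $\mu$ is $$\mu^\star(t_1^\star)+\mathbf dK(x_1^\star)\in(T_{x_1^\star}S_1)^\perp .$$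
   Context: **Problem data.** $\mathcal U\subset\mathbb R^m$ is compact, $f\colon\mathbb R^n\times\mathcal U\to\mathbb R^n$ defines the control system, $L\colon\mathbb R^n\times\mathcal U\to\mathbb R$ is the cost function, and $S_1\subset\mathbb R^n$ is a submanifold. $(T_{x_1^\star}S_1)^\perp$ is the set of covectors in $(\mathbb R^n)^*\cong\mathbb R^n$ vanishing on the tangent space $T_{x_1^\star}S_1$. $\mathbb P(\mathbb R^{n+1})=(\mathbb R^{n+1}\setminus\{0\})/(\mathbb R\setminus\{0\})$ is the projective space, $[\hat\nu]$ is the class of $\hat\nu$, and $\mathbb P(T^*\mathbb R^{n+1})=\mathbb R^{n+1}\times\mathbb P(\mathbb R^{n+1})$. Costates are written with the representative $(-1,\,\cdot\,)$, i.e. in the homogeneous coordinates used for normal extremals: $[\hat\nu]=[(\nu_0,\nu)]=[(-1,-\nu/\nu_0)]$ with $\nu_0\ne0$. **Costate in the variables $\hat x$.** With $x^0(t)=K(x(t))+\int_{t_0}^tL(x(s),u(s))\,ds$ and $x^0(t_0)=K(x(t_0))$, the quantity to be minimized is $x^0(t_1)$, and $\frac{d}{dt}[x^0(t)-K(x(t))]=L(x(t),u(t))$. Let $\hat x=(x^0,x)\in\mathbb R^{n+1}$ and let $\hat x_1^\star$ be the terminal point of the optimal trajectory in these variables. Let $\mathcal H_{\hat x_1^\star}$ be the separating hyperplane at $\hat x_1^\star$ of the Pontryagin maximum principle: a hyperplane separating the set of forbidden directions $\mathbb R_{\le0}\times T_{x_1^\star}S_1$ from the interior of the terminal cone, i.e.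 the cone, obtained by combining needle variations of the optimal control and temporal variations at $t_1^\star$, that approximates the reachable set near $\hat x_1^\star$. The terminal costate corresponding to $\hat x$ is the class $[\hat\nu_{\hat x_1^\star}]=[(-1,\lambda^\star(t_1^\star))]$ with $\ker\hat\nu_{\hat x_1^\star}=\mathcal H_{\hat x_1^\star}$; the representative is chosen, by convention, to pair nonnegatively with $\mathbb R_{\le0}\times T_{x_1^\star}S_1$. It satisfies $\lambda^\star(t_1^\star)\in(T_{x_1^\star}S_1)^\perp$. **Costate in the variables $\hat y$.** In the variables $\hat y=(y^0,y)$ the system is $\dot y^0=L(y,u)$, $\dot y=f(y,u)$, $y^0(t_0)=0$, and the optimal flow of $(\hat y,\mu)$ is the contact Hamiltonian flow on $\mathbb P(T^*\mathbb R^{n+1})$ with contact Hamiltonian $h(\hat y,\mu)=\mu_if^i(y,u^\star)-L(y,u^\star)$, where $u^\star$ is the optimal control. That is, it is the flow of the vector field $X_h$ with $\theta(X_h)=h$ and $\mathbf i_{X_h}\omega=\mathbf dh-(\mathbf dh\cdot R_\theta)\theta$, where $\theta=-\mathbf dy^0+\mu_i\,\mathbf dy^i$, $\omega=-\mathbf d\theta$, and the Reeb vector field $R_\theta$ is defined by $\theta(R_\theta)=1$, $\mathbf i_{R_\theta}\omega=0$. Let $\Phi_K\colon\mathbb R^{n+1}\to\mathbb R^{n+1}$, $\Phi_K(x^0,x)=(x^0-K(x),x)=(y^0,y)$, a diffeomorphism with inverse $\Phi_{-K}$. The separating hyperplane at $\hat y_1^\star=\Phi_K(\hat x_1^\star)$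 is $T_{\hat x_1^\star}\Phi_K(\mathcal H_{\hat x_1^\star})$, and the terminal costate corresponding to $\hat y$ is $$[(-1,\mu^\star(t_1^\star))]=[T^*_{\hat x_1^\star}\Phi_K^{-1}(\hat\nu_{\hat x_1^\star})],$$ where $T^*_{\hat x_1^\star}\Phi_K^{-1}(\hat\nu)=\hat\nu\circ(T_{\hat x_1^\star}\Phi_K)^{-1}$, a covector whose kernel is that hyperplane. The two costates are related by the projectivized cotangent lift $\Psi_K=[T^*\Phi_K]$ as $(x^0,x,\lambda)=\Psi_K(y^0,y,\mu)=(y^0+K(y),\,y,\,\mu+\mathbf dK(y))$. *)

(* Defs.v *)
From HB Require Import structures.
From mathcomp Require Import all_boot all_order all_algebra.
From mathcomp Require Import all_classical all_reals all_analysis.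
Set Implicit Arguments.
Unset Strict Implicit.
Unset Printing Implicit Defensive.
Import Order.TTheory GRing.Theory Num.Theory.
Import numFieldNormedType.Exports.
Local Open Scope classical_set_scope.
Local Open Scope ring_scope.

Section differential_geometry.
Context {R : realType}.

(* For k = k'.+1 the directional derivatives in all fixed directions are the
   coordinates of the differential, so this is C^k on an open set A of a
   finite-dimensional space. *)
Fixpoint Ck_on {V W : normedModType R} (k : nat) (A : set V) (g : V -> W) :
    Prop :=
  if k is k'.+1 then
    (forall x, A x -> differentiable g x) /\
    (forall v, Ck_on k' A (fun x => 'D_v g x))
  else forall x, A x -> {for x, continuous g}.

Definition smooth_on {V W : normedModType R} (A : set V) (g : V -> W) : Prop :=
  forall k, Ck_on k A g.

(* Embedded submanifold of codimension k: locally the zero set of a smooth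
   submersion onto R^k. *)
Definition submanifold {n : nat} (S : set 'rV[R]_n) : Prop :=
  exists k : nat, forall p, S p ->
    exists (W : set 'rV[R]_n) (g : 'rV[R]_n -> 'rV[R]_k),
      [/\ open W, W p, smooth_on W g,
          (forall x, W x -> range ('d g x) = setT)
        & S `&` W = [set x | W x /\ g x = 0]].

Definition tangent_space {n : nat} (S : set 'rV[R]_n) (p : 'rV[R]_n) :
    set 'rV[R]_n :=
  [set v | exists (c : R -> 'rV[R]_n) (e : R),
     [/\ 0 < e, smooth_on `]- e, e[ c,
         (forall s, s \in `]- e, e[ -> S (c s)),
         c 0 = p & is_derive (0 : R) (1 : R) c v]].

(* Covectors of R^n are identified with row vectors through the standard
   pairing. *)
Definition pairing {n : nat} (p v : 'rV[R]_n) : R := \sum_i p 0 i * v 0 i.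

Definition annihilator {n : nat} (T : set 'rV[R]_n) : set 'rV[R]_n :=
  [set p | forall v, T v -> pairing p v = 0].

(* The covector dK(x), that is, pairing (dcov K x) v = 'd K x v. *)
Definition dcov {n : nat} (K : 'rV[R]_n -> R) (x : 'rV[R]_n) : 'rV[R]_n :=
  \row_i 'd K x (delta_mx 0 i).

End differential_geometry.

(* R^{n+1} = R x R^n, with points (x^0, x). *)
Notation hat R n := (R * 'rV[R]_n)%type.

Section projective.
Context {R : realType} {n : nat}.

Definition covec (p : hat R n) : hat R n -> R :=
  fun v => p.1 * v.1 + pairing p.2 v.2.

(* The point [nu] of the projectivization: all nonzero multiples of nu. *)
Definition proj_class (nu : hat R n -> R) : set (hat R n -> R) :=
  [set eta | exists2 c : R, c != 0 & eta = (fun v => c * nu v)].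

Definition Phi (K : 'rV[R]_n -> R) : hat R n -> hat R n :=
  fun z => (z.1 - K z.2, z.2).

(* (T^*_x F^{-1}) nu = nu \o (T_x F)^{-1}, for F a diffeomorphism. *)
Definition cotangent_lift_inv (F : hat R n -> hat R n) (x : hat R n)
    (nu : hat R n -> R) : hat R n -> R :=
  nu \o 'pinv_(fun=> 0) setT ('d F x).

End projective.

Section control.
Context {R : realType}.
Local Notation leb := (@lebesgue_measure R).

(* z is absolutely continuous on [a, b] with derivative g almost everywhere,
   in integral form.  V is meant to be finite-dimensional; testing against all
   linear functionals is then the same as working coordinatewise. *)
Definition ac_primitive {V : normedModType R} (a b : R) (g z : R -> V) : Prop :=
  forall l : {linear V -> R^o},
    leb.-integrable `[a, b] (fun s => (l (g s) : R)%:E) /\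
    forall t, t \in `[a, b] ->
      l (z t) = l (z a) + \int[leb]_(s in `[a, t]) (l (g s) : R).

Context {n m : nat}.
Implicit Types (f : 'rV[R]_n -> 'rV[R]_m -> 'rV[R]_n)
  (L : 'rV[R]_n -> 'rV[R]_m -> R) (K : 'rV[R]_n -> R)
  (U : set 'rV[R]_m) (S : set 'rV[R]_n) (t : R)
  (u : R -> 'rV[R]_m) (x : R -> 'rV[R]_n).

(* The values of u and x outside [t0, t1] are irrelevant. *)
Record admissible U f L S1 t0 (x0 : 'rV[R]_n) u x t1 : Prop := {
  adm_time : t0 < t1 ;
  adm_meas : forall l : {linear 'rV[R]_m -> R^o},
    measurable_fun `[t0, t1] (fun s => l (u s) : R) ;
  adm_ctrl : forall s, s \in `[t0, t1] -> U (u s) ;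
  adm_ode : ac_primitive t0 t1 (fun s => f (x s) (u s)) x ;
  adm_cost : leb.-integrable `[t0, t1] (fun s => (L (x s) (u s))%:E) ;
  adm_init : x t0 = x0 ;
  adm_term : S1 (x t1) }.

Definition running_cost L t0 x u t : R :=
  \int[leb]_(s in `[t0, t]) L (x s) (u s).

Definition total_cost K L t0 x u t1 : R := K (x t1) + running_cost L t0 x u t1.

Definition optimal U f L K S1 t0 (x0 : 'rV[R]_n) u x t1 : Prop :=
  admissible U f L S1 t0 x0 u x t1 /\
  forall u' x' t1', admissible U f L S1 t0 x0 u' x' t1' ->
    total_cost K L t0 x u t1 <= total_cost K L t0 x' u' t1'.

Definition xhat K L t0 x u : R -> hat R n :=
  fun t => (K (x t) + running_cost L t0 x u t, x t).

(* Right-hand side of the system in the variables (x^0, x). *)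
Definition fhat f L K (w : 'rV[R]_m) : hat R n -> hat R n :=
  fun z => (L z.2 w + 'd K (z.2) (f z.2 w), f z.2 w).

(* xi solves on [b, t1] the linearization along the trajectory (z, u) of the
   system with right-hand side F. *)
Definition variational_solution (F : 'rV[R]_m -> hat R n -> hat R n)
    u (z : R -> hat R n) (b t1 : R) (xi : R -> hat R n) : Prop :=
  (forall s, s \in `[b, t1] -> differentiable (F (u s)) (z s)) /\
  ac_primitive b t1 (fun s => 'd (F (u s)) (z s) (xi s)) xi.

(* Needle variation at a regular time b with control value w, transported to
   the terminal time t1. *)
Definition needle_variation U (F : 'rV[R]_m -> hat R n -> hat R n)
    u (z : R -> hat R n) t0 t1 : set (hat R n) :=
  [set v | exists (b : R) (w : 'rV[R]_m) (xi : R -> hat R n),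
     [/\ t0 < b < t1, U w,
         forall l : {linear hat R n -> R^o},
           lebesgue_pt (fun s => l (F (u s) (z s)) : R) b,
         variational_solution F u z b t1 xi
       & xi b = F w (z b) - F (u b) (z b) /\ v = xi t1]].

(* The terminal velocity is taken from the left: for a control with a left
   limit u(t1-) it is F (u(t1-)) (z t1). *)
Definition temporal_variation (z : R -> hat R n) t1 : set (hat R n) :=
  [set v | exists tau : hat R n,
     h^-1 *: (z t1 - z (t1 - h)) @[h --> (0 : R)^'+] --> tau /\
     (v = tau \/ v = - tau)].

Definition convex_cone {V : lmodType R} (G : set V) : set V :=
  [set v | exists (N : nat) (c : 'I_N -> R) (g : 'I_N -> V),
     (forall i, 0 <= c i /\ G (g i)) /\ v = \sum_i c i *: g i].

Definition terminal_cone U f L K t0 u x t1 : set (hat R n) :=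
  convex_cone (needle_variation U (fhat f L K) u (xhat K L t0 x u) t0 t1
               `|` temporal_variation (xhat K L t0 x u) t1).

Definition forbidden S1 (p : 'rV[R]_n) : set (hat R n) :=
  [set v | v.1 <= 0 /\ tangent_space S1 p v.2].

(* A hyperplane is given by its direction, a linear hyperplane of the tangent
   space R^{n+1}. *)
Definition separates (H A B : set (hat R n)) : Prop :=
  exists nu : {linear hat R n -> R^o},
    [/\ exists v, nu v != 0, H = [set v | nu v = 0],
        forall v, A v -> 0 <= (nu v : R) & forall v, B v -> (nu v : R) <= 0].

Definition separating_hyperplane U f L K S1 t0 u x t1 (H : set (hat R n)) :
    Prop :=
  separates H (forbidden S1 (x t1)) (terminal_cone U f L K t0 u x t1)^°.

Definition terminal_costate_xhat S1 (p : 'rV[R]_n) (H : set (hat R n))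
    (lambda1 : 'rV[R]_n) : Prop :=
  [set v | covec (-1, lambda1) v = 0] = H /\
  forall v, forbidden S1 p v -> 0 <= covec (-1, lambda1) v.

End control.

(* Points (y^0, y, mu) of the chart mu_0 = -1 of P(T^* R^{n+1}), on which the
   contact form below lives. *)
Notation contact_chart R n := (R * 'rV[R]_n * 'rV[R]_n)%type.

Section contact.
Context {R : realType} {n m : nat}.
Local Notation M := (contact_chart R n).

Definition theta (z : M) (v : M) : R := - v.1.1 + pairing z.2 v.1.2.

(* omega = - d theta, where d theta (v, w) = v (theta w) - w (theta v) for
   constant vector fields v, w. *)
Definition omega (z : M) (v w : M) : R :=
  - ('D_v (fun z' => theta z' w) z - 'D_w (fun z' => theta z' v) z).

Definition is_reeb (X : M -> M) : Prop :=
  forall z, theta z (X z) = 1 /\ forall w, omega z (X z) w = 0.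

(* v is the value at z of the contact Hamiltonian vector field of h. *)
Definition contact_hamiltonian_vector (h : M -> R) (z v : M) : Prop :=
  differentiable h z /\
  exists2 Reeb : M -> M, is_reeb Reeb &
    theta z v = h z /\
    forall w, omega z v w = 'd h z w - 'd h z (Reeb z) * theta z w.

Definition control_hamiltonian (f : 'rV[R]_n -> 'rV[R]_m -> 'rV[R]_n)
    (L : 'rV[R]_n -> 'rV[R]_m -> R) (w : 'rV[R]_m) : M -> R :=
  fun z => pairing z.2 (f z.1.2 w) - L z.1.2 w.

(* z is an integral curve on [t0, t1] of the time-dependent contact Hamiltonian
   vector field obtained by inserting the control u. *)
Definition contact_flow_line (f : 'rV[R]_n -> 'rV[R]_m -> 'rV[R]_n)
    (L : 'rV[R]_n -> 'rV[R]_m -> R) (t0 t1 : R) (u : R -> 'rV[R]_m)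
    (z : R -> M) : Prop :=
  exists2 X : R -> M,
    forall s, s \in `[t0, t1] ->
      contact_hamiltonian_vector (control_hamiltonian f L (u s)) (z s) (X s) &
    ac_primitive t0 t1 X z.

(* mu is the costate in the variables yhat = Phi K xhat: (yhat, mu) follows the
   contact Hamiltonian flow, and at t1 it is the cotangent lift of the terminal
   costate (-1, lambda1) in the variables xhat. *)
Definition costate_yhat (f : 'rV[R]_n -> 'rV[R]_m -> 'rV[R]_n)
    (L : 'rV[R]_n -> 'rV[R]_m -> R) (K : 'rV[R]_n -> R) (t0 t1 : R)
    (u : R -> 'rV[R]_m) (x : R -> 'rV[R]_n) (lambda1 : 'rV[R]_n)
    (mu : R -> 'rV[R]_n) : Prop :=
  contact_flow_line f L t0 t1 u
    (fun t => (Phi K (xhat K L t0 x u t), mu t)) /\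
  proj_class (covec (-1, mu t1)) =
  proj_class (cotangent_lift_inv (Phi K) (xhat K L t0 x u t1)
                (covec (-1, lambda1))).

End contact.

(* Main.v *)
Require Import Defs.
From mathcomp Require Import all_boot all_order all_algebra.
From mathcomp Require Import all_classical all_reals all_analysis.
Import Order.TTheory GRing.Theory Num.Theory.
Import numFieldNormedType.Exports.
Local Open Scope classical_set_scope.
Local Open Scope ring_scope.

(** The differential of Phi_K sends (a, v) to (a - dK v, v), so the cotangent
    lift of (-1, lambda) is (-1, lambda - dK): equality of the projective
    classes forces mu + dK = lambda, the factor being fixed by the common
    coordinate -1.  Since the forbidden directions contain {0} x T S1 and T S1
    is stable under v |-> -v, nonnegativity of lambda on them means that lambda
    vanishes on T S1. *)

Section linear_algebra.
Context {R : realType} {n : nat}.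
Implicit Types p q v : 'rV[R]_n.

Lemma pairingDl p q v : pairing (p + q) v = pairing p v + pairing q v.
Proof. by rewrite -big_split; apply: eq_bigr => i _; rewrite mxE mulrDl. Qed.

Lemma pairingNr p v : pairing p (- v) = - pairing p v.
Proof. by rewrite -sumrN; apply: eq_bigr => i _; rewrite mxE mulrN. Qed.

Lemma pairing0r p : pairing p 0 = 0.
Proof. by apply: big1 => i _; rewrite mxE mulr0. Qed.

Lemma pairing_dcov (K : 'rV[R]_n -> R) (x v : 'rV[R]_n) :
  pairing (dcov K x) v = 'd K x v.
Proof.
rewrite [in RHS](row_sum_delta v) linear_sum; apply: eq_bigr => i _.
by rewrite mxE linearZ mulrC.
Qed.

End linear_algebra.

Section reversal.
Context {R : realType}.

(** The quotients agree for every [h], before any limit, so one identity transfers both derivability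
    and the value of the derivative. *)
Lemma diff_quotient_comp_opp {V W : normedModType R} (g : V -> W) (x v : V) :
  (fun h : R => h^-1 *: (((g \o -%R) \o shift x) (h *: v) - (g \o -%R) x)) =
  (fun h : R => h^-1 *: ((g \o shift (- x)) (h *: - v) - g (- x))).
Proof. by apply/funext => h; rewrite /= opprD scalerN. Qed.

Lemma derive_comp_opp {V W : normedModType R} (g : V -> W) (x v : V) :
  'D_v (g \o -%R) x = 'D_(- v) g (- x).
Proof. by rewrite /derive diff_quotient_comp_opp. Qed.

Lemma derivable_comp_opp {V W : normedModType R} (g : V -> W) (x v : V) :
  derivable (g \o -%R) x v = derivable g (- x) (- v).
Proof. by rewrite /derivable diff_quotient_comp_opp. Qed.

(** Induction on [k] with [g] generalized: a directional derivative of [g \o -%R] is again a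
    composite with [-%R], now of the derivative of [g] along the opposite vector. *)
Lemma Ck_on_comp_opp {V W : normedModType R} k (A : set V) (g : V -> W) :
  (forall x, A x -> A (- x)) -> Ck_on k A g -> Ck_on k A (g \o -%R).
Proof.
move=> AN; elim: k g => [|k IHk] g /=.
  move=> gc x /AN Ax; apply: continuous_comp; first exact: opp_continuous.
  exact: gc.
move=> [gd gk]; split=> [x /AN Ax|v].
  apply: differentiable_comp; last exact: gd.
  by apply: linear_differentiable; exact: opp_continuous.
rewrite (_ : (fun x => _) = (fun x => 'D_(- v) g x) \o -%R); first exact: IHk.
by apply/funext => x; exact: derive_comp_opp.
Qed.

(** Running the curve backwards reverses its velocity, and its interval of definition is
    symmetric. *)
Lemma tangent_spaceN {n : nat} (S : set 'rV[R]_n) (p v : 'rV[R]_n) :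
  tangent_space S p v -> tangent_space S p (- v).
Proof.
move=> [c [e [e0 cs cS c0 [cd cv]]]].
have IN (s : R) : s \in `]- e, e[ -> - s \in `]- e, e[.
  by rewrite !in_itv /= ltrN2 (ltrNl s e) andbC.
(* Differentiability, from smoothness at order 1, makes ['D_w c 0] linear in [w]; this turns the
   derivative along [1] into the one along [-1]. *)
have cd0 : differentiable c 0.
  by apply: (cs 1%N).1; rewrite /= in_itv /= oppr_lt0 e0.
exists (c \o -%R), e; split => //.
- by move=> k; apply: Ck_on_comp_opp.
- by move=> s /IN; exact: cS.
- by rewrite /= oppr0.
- split.
    by rewrite derivable_comp_opp oppr0; exact: diff_derivable.
  by rewrite derive_comp_opp oppr0 deriveE // linearN -deriveE // cv.
Qed.

End reversal.

Section Phi.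
Context {R : realType} {n : nat} (K : 'rV[R]_n -> R).

Lemma diff_Phi (z : hat R n) : differentiable K z.2 ->
  'd (Phi K) z = (fun v => (v.1 - 'd K (z.2) v.2, v.2)) :> (hat R n -> hat R n).
Proof.
move=> dK.
(* The three [is_diff] facts serve as local instances from which [is_diff_pair] assembles the
   differential. *)
have fst_diff : is_diff z (fst : hat R n -> R) fst.
  have fc : continuous (fst : hat R n -> R) by move=> w; exact: cvg_fst.
  by apply: DiffDef; [exact: linear_differentiable|exact: diff_lin].
have snd_diff : is_diff z (snd : hat R n -> 'rV[R]_n) snd.
  have fc : continuous (snd : hat R n -> 'rV[R]_n) by move=> w; exact: cvg_snd.
  by apply: DiffDef; [exact: linear_differentiable|exact: diff_lin].
have K_diff : is_diff (z.2) K ('d K (z.2)) by exact: differentiableP.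
have Phi_diff : is_diff z (Phi K) (fun v => (v.1 - 'd K (z.2) v.2, v.2)).
  apply: is_diff_pair.
exact: diff_val.
Qed.

(** Evaluating the lift on the image of [v] under the differential avoids inverting it: the
    pseudo-inverse returns [v] because the differential is injective. *)
Lemma cotangent_lift_inv_Phi (z v : hat R n) (nu : hat R n -> R) :
  differentiable K z.2 ->
  cotangent_lift_inv (Phi K) z nu (v.1 - 'd K (z.2) v.2, v.2) = nu v.
Proof.
move=> dK; rewrite /cotangent_lift_inv diff_Phi //=.
set D := (fun w => (_, _)).
have DK : {in setT, cancel D ('pinv_(fun=> 0) setT D)}.
  apply: pinvKV => -[a w] [b w'] _ _; rewrite /D /=.
  by move=> [+ eq_w]; rewrite eq_w => /addIr ->.
by rewrite -[(_, _)]/(D v) DK ?inE.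
Qed.

End Phi.

Theorem mainTheorem2 (R : realType) (n m : nat)
    (U : set 'rV[R]_m) (f : 'rV[R]_n -> 'rV[R]_m -> 'rV[R]_n)
    (L : 'rV[R]_n -> 'rV[R]_m -> R) (S1 : set 'rV[R]_n)
    (K : 'rV[R]_n -> R) (t0 : R) (x0 : 'rV[R]_n)
    (ustar : R -> 'rV[R]_m) (xstar : R -> 'rV[R]_n) (t1star : R)
    (H : set (hat R n)) (lambda1 : 'rV[R]_n) (mustar : R -> 'rV[R]_n) :
  compact U ->
  submanifold S1 ->
  smooth_on setT K ->
  optimal U f L K S1 t0 x0 ustar xstar t1star ->
  separating_hyperplane U f L K S1 t0 ustar xstar t1star H ->
  terminal_costate_xhat S1 (xstar t1star) H lambda1 ->
  costate_yhat f L K t0 t1star ustar xstar lambda1 mustar ->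
  annihilator (tangent_space S1 (xstar t1star))
    (mustar t1star + dcov K (xstar t1star)).
Proof.
move=> _ _ Ksmooth _ _ [_ lambda_ge0] [_ classE] v Tv.
set p := xstar t1star in Tv lambda_ge0 *.
have dK : differentiable K p := (Ksmooth 1%N).1 p I.
have lambda_v0 : pairing lambda1 v = 0.
  have ge0 w : tangent_space S1 p w -> 0 <= pairing lambda1 w.
    move=> Tw; have /= := lambda_ge0 (0, w) (conj (lexx 0) Tw).
    by rewrite /covec /= mulr0 add0r.
  apply/eqP; rewrite eq_le ge0 // andbT -oppr_ge0 -pairingNr.
  exact/ge0/tangent_spaceN.
(* A covector lies in its own class, with factor 1; [classE] moves it to the class of the lift, and
   [c] is the resulting factor. *)
have [c _ muE] : proj_class (cotangent_lift_inv (Phi K)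
    (xhat K L t0 xstar ustar t1star) (covec (-1, lambda1)))
    (covec (-1, mustar t1star)).
  by rewrite -classE; exists 1; rewrite ?oner_neq0 //; apply/funext => w;
    rewrite mul1r.
have muD (w : hat R n) :
    covec (-1, mustar t1star) (w.1 - 'd K p w.2, w.2) =
    c * covec (-1, lambda1) w.
  by rewrite muE cotangent_lift_inv_Phi.
(* The differential of [Phi K] fixes [(1, 0)], where both covectors take the value -1. *)
have c1 : c = 1.
  have := muD (1, 0); rewrite /covec /= linear0 !pairing0r subr0 !addr0.
  by rewrite !mulr1 mulrN1 => /oppr_inj.
(* The image of [(0, v)] is [(- 'd K p v, v)]; the coordinate -1 turns its first entry into
   [+ 'd K p v], the term added to the pairing of [mustar t1star] with [v]. *)
have := muD (0, v); rewrite c1 mul1r /covec /= lambda_v0 addr0 mulr0.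
by rewrite sub0r mulrNN mul1r pairingDl pairing_dcov addrC.
Qed.
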